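(* Let $n\ge 2$ be an integer, let $a$ be a real number with $\frac{1}{n+1}<a\le\frac1n$, let $p\in L^1([0,1],\mathfrak B,\lambda)$ with $p\ge 0$, let $\mu(B)=\int_B p\,d\lambda$, and let $\alpha=\{\alpha_1,\alpha_2\}$ be a set of weight functions on $[0,1]$. Let $\mu_S$ be the measure obtained from $\mu$ by the equipped $2$-transformation $\{S,\alpha\}$, $S=S(a)=S_1\cup S_2$. Then $\mu_S=\mu$ if and only if the following three conditions hold (each for $\lambda$-almost every value of the indicated variable): (i) for $x_0\in[a,1-(n-1)a)$, $$\sum_{k=-1}^{n-1}p(x_0+ka)=\frac{1}{1-a}\sum_{k=-1}^{n-2}p\!\left(\frac{x_0+ka}{1-a}\right);$$ (ii) for $x_1\in[1-(n-1)a,2a)$, $$\sum_{k=-1}^{n-2}p(x_1+ka)=\frac{1}{1-a}\sum_{k=-1}^{n-3}p\!\left(\frac{x_1+ka}{1-a}\right);$$ (iii) $$\alpha_1(x+ma)\,p(x+ma)=\sum_{k=-1}^{m}p(x+ka)-\frac{1}{1-a}\sum_{k=-1}^{m-1}p\!\left(\frac{x+ka}{1-a}\right)$$ for every integer $m$ with $0\le m\le n-3$ and $x+ma\in[(m+1)a,(m+2)a)$, and also for $m=n-2$ and $x+(n-2)a\in[(n-1)a,1-a)$. There is no restriction on the function $\alpha_1$ on the intervals $[0,a)$ and $[1-a,1]$ (i.e. whether $\mu_S=\mu$ holds does not depend on the values of $\alpha_1$ there).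
   Context: $\lambda$ is Lebesgue measure on $[0,1]$ and $\mathfrak B$ is the $\sigma$-field of Borel subsets of $[0,1]$. For $a\in(0,\frac12]$ define $S_1,S_2:[0,1]\to[0,1]$ by $$S_1(x)=\begin{cases}\frac{x}{1-a},&x\in[0,1-a),\\ \frac{x-a}{1-a},&x\in[1-a,1],\end{cases}\qquad S_2(x)=\begin{cases}\frac{x}{1-a},&x\in[0,a),\\ \frac{x-a}{1-a},&x\in[a,1].\end{cases}$$ The $2$-valued transformation is $S=S(a)=S_1\cup S_2$. A set of weight functions (an ''equipment'' of $S$) is a pair $\alpha=\{\alpha_1,\alpha_2\}$ with $\alpha_1,\alpha_2\in L^1([0,1],\mathfrak B,\lambda)$, $\alpha_1,\alpha_2\ge 0$ and $\alpha_1(x)+\alpha_2(x)\equiv 1$. Given $\mu=\int p\,d\lambda$, the measure $\mu_S$ is defined for $B\in\mathfrak B$ by $$\mu_S(B)=\int_{S_1^{-1}(B)}\alpha_1(x)p(x)\,d\lambda+\int_{S_2^{-1}(B)}\alpha_2(x)p(x)\,d\lambda.$$ Empty intervals are allowed: a condition over an empty interval is vacuous. *)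

(* Defs.v *)
From HB Require Import structures.
From mathcomp Require Import all_boot all_order all_algebra.
From mathcomp Require Import all_classical all_reals all_analysis.

Set Implicit Arguments.
Unset Strict Implicit.
Unset Printing Implicit Defensive.

Import Order.TTheory GRing.Theory Num.Theory.
Import numFieldNormedType.Exports.

Local Open Scope classical_set_scope.
Local Open Scope ring_scope.

(* Functions on [0, 1] are represented by functions R -> R; only their values
   on [0, 1] are ever used. *)

Definition S1 (R : realType) (a x : R) : R :=
  if x < 1 - a then x / (1 - a) else (x - a) / (1 - a).

Definition S2 (R : realType) (a x : R) : R :=
  if x < a then x / (1 - a) else (x - a) / (1 - a).

(* Elements of L^1 are taken up to null sets, so pointwise relations between
   them are required almost everywhere on [0, 1]. *)
Record density (R : realType) (p : R -> R) : Prop := Density {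
  density_integrable :
    (@lebesgue_measure R).-integrable `[0, 1] (EFin \o p);
  density_ge0 :
    {ae @lebesgue_measure R, forall x, x \in `[0, 1] -> 0 <= p x} }.

Record weight_functions (R : realType) (alpha1 alpha2 : R -> R) : Prop :=
  WeightFunctions {
    weight1 : density alpha1;
    weight2 : density alpha2;
    weight_sum1 :
      {ae @lebesgue_measure R, forall x, x \in `[0, 1] -> alpha1 x + alpha2 x = 1} }.

Definition mu_of (R : realType) (p : R -> R) (B : set R) : \bar R :=
  \int[@lebesgue_measure R]_(x in B) (p x)%:E.

Definition muS_of (R : realType) (T1 T2 alpha1 alpha2 p : R -> R)
    (B : set R) : \bar R :=
  (\int[@lebesgue_measure R]_(x in `[0%R, 1%R] `&` T1 @^-1` B)
      (alpha1 x * p x)%:E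
   + \int[@lebesgue_measure R]_(x in `[0%R, 1%R] `&` T2 @^-1` B)
      (alpha2 x * p x)%:E)%E.

Definition eq_borel01 (R : realType) (mu nu : set R -> \bar R) : Prop :=
  forall B : set R, measurable B -> B `<=` `[0, 1] -> mu B = nu B.

Definition S_invariant (R : realType) (a : R) (alpha1 alpha2 p : R -> R) : Prop :=
  eq_borel01 (muS_of (S1 a) (S2 a) alpha1 alpha2 p) (mu_of p).

(* The sum of F k over the integers -1 <= k <= M, which has M + 2 terms; only
   meaningful for -1 <= M. *)
Definition sum_from_m1 (R : realType) (M : int) (F : int -> R) : R :=
  \sum_(j < `|(M + 2)%R|%N) F (j%:Z - 1).

Definition cond_i (R : realType) (n : nat) (a : R) (p : R -> R) : Prop :=
  {ae @lebesgue_measure R, forall x, x \in `[a, 1 - (n%:R - 1) * a[ ->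
    sum_from_m1 (n%:Z - 1) (fun k => p (x + k%:~R * a)) =
    1 / (1 - a) *
      sum_from_m1 (n%:Z - 2) (fun k => p ((x + k%:~R * a) / (1 - a)))}.

Definition cond_ii (R : realType) (n : nat) (a : R) (p : R -> R) : Prop :=
  {ae @lebesgue_measure R, forall x, x \in `[1 - (n%:R - 1) * a, 2 * a[ ->
    sum_from_m1 (n%:Z - 2) (fun k => p (x + k%:~R * a)) =
    1 / (1 - a) *
      sum_from_m1 (n%:Z - 3) (fun k => p ((x + k%:~R * a) / (1 - a)))}.

Definition weight_eq (R : realType) (a : R) (alpha1 p : R -> R) (m : nat)
    (x : R) : Prop :=
  alpha1 (x + m%:R * a) * p (x + m%:R * a) =
  sum_from_m1 m%:Z (fun k => p (x + k%:~R * a))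
  - 1 / (1 - a) *
      sum_from_m1 (m%:Z - 1) (fun k => p ((x + k%:~R * a) / (1 - a))).

Definition cond_iii (R : realType) (n : nat) (a : R) (alpha1 p : R -> R) : Prop :=
  (forall m : nat, (m + 3 <= n)%N ->
    {ae @lebesgue_measure R, forall x,
      x + m%:R * a \in `[(m%:R + 1) * a, (m%:R + 2) * a[ ->
      weight_eq a alpha1 p m x})
  /\
  {ae @lebesgue_measure R, forall x,
    x + (n - 2)%N%:R * a \in `[(n%:R - 1) * a, 1 - a[ ->
    weight_eq a alpha1 p (n - 2)%N x}.

(* Main.v *)
(* Push the mass at [x] through the 2-valued map: an amount [left_mass x] goes to
   [x / (1 - a)] and the rest to [(x - a) / (1 - a)].  A point [y] of [[0, 1[]
   receives mass only from [x = (1 - a) y + a] and from [x - a], so an affine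
   change of variables turns invariance into
     left_mass x = left_mass (x - a) + p x - p ((x - a) / (1 - a)) / (1 - a)
   for almost every [x] in [[a, 1[].  As [left_mass = p] on [[0, a[], summing
   along [x, x + a, x + 2a, ...] from [x] in [[a, 2a[] gives [left_mass] in
   closed form; it is [alpha1 p] on [[a, 1 - a[], which is (iii), and vanishes
   on [[1 - a, 1[], which is (i) and (ii). *)

Require Import Defs.
From HB Require Import structures.
From mathcomp Require Import all_boot all_order all_algebra.
From mathcomp Require Import all_classical all_reals all_analysis.
From mathcomp Require Import measurable_realfun.
From mathcomp Require Import zify ring lra.

Set Implicit Arguments.
Unset Strict Implicit.
Unset Printing Implicit Defensive.

Import Order.TTheory GRing.Theory Num.Theory.
Import numFieldNormedType.Exports.

Local Open Scope classical_set_scope.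
Local Open Scope ring_scope.

(* Makes [filterS] and its variants apply to properties of points of [R] itself
   rather than of the type of which [lebesgue_measure] is officially a measure. *)
Instance lebesgue_ae_filter (R : realType) :
  Filter (nbhs (almost_everywhere (@lebesgue_measure R))).
Proof. exact: ae_filter_ringOfSetsType. Qed.

(** * Affine change of variables for Lebesgue measure *)

Section affine_change_of_variables.
Context (R : realType) (b d : R) (b_gt0 : 0 < b).

Local Notation lambda := (@lebesgue_measure R).
Local Notation aff := (fun y : R => b * y + d).

Lemma measurable_affine : measurable_fun [set: R] aff.
Proof. by apply: measurable_funD => //; exact: measurable_funM. Qed.

Lemma measurable_affine_preimage (A : set R) :
  measurable A -> measurable (aff @^-1` A).
Proof. by move=> mA; rewrite -[_ @^-1` _]setTI; exact: measurable_affine. Qed.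

(** By uniqueness of Lebesgue measure: the pushforward under [aff], scaled by [b], gives each
    interval []x, y]] its length. *)
Lemma lebesgue_measure_affine (A : set R) : measurable A ->
  lambda A = (b%:E * lambda (aff @^-1` A))%E.
Proof.
move=> mA.
apply: (@lebesgue_measure_unique _ (mscale (NngNum (ltW b_gt0))
  (pushforward lambda (aff : measurableTypeR R -> measurableTypeR R)))) => //.
  exact: measurable_affine.
move=> mf X [[x y] _ <-].
transitivity (b%:E * lambda (aff @^-1` `]x, y]))%E; last by [].
rewrite (_ : _ @^-1` _ = `](x - d) / b, (y - d) / b]%classic); last first.
  apply/seteqP; split=> z /=; rewrite !in_itv/= ltr_pdivrMr// ler_pdivlMr//;
  by rewrite ltrBlDr lerBrDr (mulrC z).
rewrite !lebesgue_measure_itv/= !lte_fin ltr_pM2r ?invr_gt0// ltrD2r.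
case: ifPn; last by rewrite mule0.
rewrite -!EFinB -EFinM => _; congr EFin.
by rewrite -mulrBl mulrC divfK ?gt_eqF//; ring.
Qed.

(** Since [b] is nonzero, the scaling formula forces the preimage of a null set to be null. This
    carries almost-everywhere statements between a point, its translates and its images. *)
Lemma ae_affine (P : R -> Prop) :
  {ae lambda, forall x, P x} -> {ae lambda, forall y, P (b * y + d)}.
Proof.
move=> [N [mN N0 PN]]; exists (aff @^-1` N); split.
- exact: measurable_affine_preimage.
- have := lebesgue_measure_affine mN; rewrite N0 => /esym/eqP.
  by rewrite mule_eq0 eqe gt_eqF//= => /eqP.
- by move=> y; exact: PN.
Qed.

Lemma ge0_integral_affine (D : set R) (f : R -> \bar R) :
  measurable D -> measurable_fun [set: R] f -> (forall x, (0 <= f x)%E) ->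
  (\int[lambda]_(x in D) f x =
   b%:E * \int[lambda]_(y in aff @^-1` D) f (b * y + d)%R)%E.
Proof.
move=> mD mf f0.
have maff : measurable_fun [set: measurableTypeR R]
  (aff : measurableTypeR R -> measurableTypeR R) by exact: measurable_affine.
pose nu := mscale (NngNum (ltW b_gt0))
  (pushforward lambda (aff : measurableTypeR R -> measurableTypeR R)).
transitivity (\int[nu maff]_(x in D) f x)%E; rewrite /nu.
  by apply: eq_measure_integral => //= A mA _; exact: lebesgue_measure_affine.
rewrite ge0_integral_mscale//; last exact: measurable_funTS.
congr (_ * _)%E.
by rewrite ge0_integral_pushforward//; exact: measurable_funTS.
Qed.

(** An infinite integral of [|f|] along [aff] would stay infinite after multiplication by [b],
    contradicting the integrability of [f]. *)
Lemma integrable_affine (f : R -> \bar R) :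
  lambda.-integrable [set: R] f ->
  lambda.-integrable [set: R] (fun y => b%:E * f (b * y + d)%R)%E.
Proof.
move=> /integrableP[mf foo].
apply: integrableZl => //; apply/integrableP; split.
  exact: (measurableT_comp mf measurable_affine).
move: foo; rewrite ge0_integral_affine//; last exact: measurableT_comp.
rewrite preimage_setT !ltey; apply: contra => /eqP /= ->.
by rewrite gt0_muley ?lte_fin.
Qed.

(** Split into positive and negative parts; both commute with composition by [aff] and with the
    positive factor [b]. *)
Lemma integral_affine (D : set R) (f : R -> \bar R) :
  measurable D -> lambda.-integrable [set: R] f ->
  (\int[lambda]_(x in D) f x =
   \int[lambda]_(y in aff @^-1` D) (b%:E * f (b * y + d)%R))%E.
Proof.
move=> mD intf; have mf := measurable_int _ intf.
have mD' := measurable_affine_preimage mD.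
have mfaff : measurable_fun [set: R] (f \o aff).
  exact: (measurableT_comp mf measurable_affine).
rewrite [LHS]integralE [RHS]integralE.
rewrite ge0_funeposM ?ltW// ge0_funenegM ?ltW//.
rewrite (@ge0_integral_affine D f^\+%E)//; last exact: measurable_funepos.
rewrite (@ge0_integral_affine D f^\-%E)//; last exact: measurable_funeneg.
rewrite -[fun y : R => f (b * y + d)]/(f \o aff).
rewrite !ge0_integralZl_EFin ?ltW//.
- by rewrite (funepos_comp f aff) (funeneg_comp f aff).
- by apply: measurable_funeneg; exact: measurable_funTS.
- by apply: measurable_funepos; exact: measurable_funTS.
Qed.

End affine_change_of_variables.

(** * Transport of an integrable function along a single affine branch *)

Section two_branches.
Context (R : realType) (b d : R) (b_gt0 : 0 < b).

Local Notation lambda := (@lebesgue_measure R).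

Lemma integrable_branch (J : set R) (phi : R -> R) : measurable J ->
  lambda.-integrable J (EFin \o phi) ->
  lambda.-integrable [set: R] (EFin \o (fun y => b * (phi \_ J) (b * y + d))).
Proof.
move=> mJ /(proj1 (@integrable_mkcond _ _ _ lambda _ (EFin \o phi) mJ)) intphi; rewrite restrict_EFin in intphi.
exact: (integrable_affine d b_gt0 intphi).
Qed.

Lemma measurable_div_shift_preimage (B : set R) :
  measurable B -> measurable [set x | B ((x - d) / b)].
Proof.
move=> mB; rewrite (_ : mkset _ = (fun x => b^-1 * x - d / b) @^-1` B).
  exact: measurable_affine_preimage.
by apply/funext => x /=; rewrite mulrBl mulrC.
Qed.

(** Extend [phi] by zero outside [J] and substitute [x = b * y + d], which turns the preimage
    condition into [y] in [B]. *)
Lemma integral_branch (J B : set R) (phi : R -> R) :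
  measurable J -> measurable B -> lambda.-integrable J (EFin \o phi) ->
  (\int[lambda]_(x in J `&` [set x | B ((x - d) / b)%R]) (phi x)%:E =
   \int[lambda]_(y in B) (b * (phi \_ J) (b * y + d))%:E)%E.
Proof.
move=> mJ mB /(proj1 (@integrable_mkcond _ _ _ lambda _ (EFin \o phi) mJ)) intphi; rewrite restrict_EFin in intphi.
rewrite integral_mkcondl -[fun x => (phi x)%:E]/(EFin \o phi) restrict_EFin.
rewrite (integral_affine d b_gt0 (measurable_div_shift_preimage mB) intphi).
congr (integral _ _ _); apply/funext => y /=.
by rewrite addrK mulrC mulKf ?gt_eqF.
Qed.

End two_branches.

(** * Image densities under a piecewise affine map with two branches *)

Section piecewise_affine_map.
Context (R : realType) (a c : R) (a_lt1 : a < 1) (c_ge0 : 0 <= c) (c_le1 : c <= 1).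

Local Notation lambda := (@lebesgue_measure R).

(** Common form of [S1], with break point [c = 1 - a], and [S2], with [c = a]. *)
Definition two_branch_map (x : R) : R :=
  if x < c then x / (1 - a) else (x - a) / (1 - a).

(** The Perron-Frobenius operator of [two_branch_map] applied to [phi]. The summand [0] gives the
    left branch the shape [b * y + d]. *)
Definition two_branch_density (phi : R -> R) (y : R) : R :=
  (1 - a) * (phi \_ `[0, c[) ((1 - a) * y + 0) +
  (1 - a) * (phi \_ `[c, 1]) ((1 - a) * y + a).

Context (phi : R -> R) (intphi : lambda.-integrable `[0, 1] (EFin \o phi)).

Let b_gt0 : 0 < 1 - a. Proof. by rewrite subr_gt0. Qed.

Let intphi0 : lambda.-integrable `[0, c[ (EFin \o phi).
Proof.
apply: integrableS intphi => // x /=; rewrite !in_itv/= => /andP[-> /ltW xc].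
exact: le_trans c_le1.
Qed.

Let intphi1 : lambda.-integrable `[c, 1] (EFin \o phi).
Proof.
apply: integrableS intphi => // x /=; rewrite !in_itv/= => /andP[cx ->].
by rewrite (le_trans c_ge0).
Qed.

Lemma integrable_two_branch_density :
  lambda.-integrable [set: R] (EFin \o two_branch_density phi).
Proof.
exact: (integrableD measurableT
  (integrable_branch 0 b_gt0 (measurable_itv _) intphi0)
  (integrable_branch a b_gt0 (measurable_itv _) intphi1)).
Qed.

Lemma integral_two_branch_map (B : set R) : measurable B ->
  (\int[lambda]_(x in `[0%R, 1%R] `&` two_branch_map @^-1` B) (phi x)%:E =
   \int[lambda]_(y in B) (two_branch_density phi y)%:E)%E.
Proof.
move=> mB.
pose D0 := `[0, c[ `&` [set x | B ((x - 0) / (1 - a))].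
pose D1 := `[c, 1] `&` [set x | B ((x - a) / (1 - a))].
have mD0 : measurable D0.
  by apply: measurableI => //; exact: measurable_div_shift_preimage.
have mD1 : measurable D1.
  by apply: measurableI => //; exact: measurable_div_shift_preimage.
(* Cutting at [c] leaves one affine branch on each piece. *)
have DE : `[0, 1] `&` two_branch_map @^-1` B = D0 `|` D1.
  apply/seteqP; split => x; rewrite /D0 /D1 /two_branch_map /= !in_itv/= subr0.
    by case: (ltP x c) => xc [/andP[x0 x1] Bx]; [left|right]; rewrite ?x0 ?x1.
  case=> -[/andP[cx xc] Bx].
    by rewrite xc cx (ltW (lt_le_trans xc c_le1)).
  by rewrite ltNge cx xc (le_trans c_ge0 cx).
rewrite DE integral_setU//; last 2 first.
- rewrite -DE; apply: measurable_funS (measurable_int _ intphi) => //.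
- apply/disj_setPS => x; rewrite /D0 /D1 /= !in_itv/=.
  by move=> [[/andP[_ xc] _] [/andP[cx _] _]]; rewrite ltNge cx in xc.
rewrite /D0 /D1 !integral_branch//.
rewrite -integralD//; last 2 first.
- by apply: integrableS (integrable_branch 0 b_gt0 (measurable_itv _) intphi0).
- by apply: integrableS (integrable_branch a b_gt0 (measurable_itv _) intphi1).
Qed.

End piecewise_affine_map.

(** * Invariance as a pointwise mass balance *)

Section transfer_equation.
Context (R : realType) (a : R) (p : R -> R).
Context (a_gt0 : 0 < a) (a_le2 : a <= 1 / 2) (p_density : density p).

Local Notation lambda := (@lebesgue_measure R).

Let a_lt1 : a < 1. Proof. by move: a_le2; lra. Qed.

(** Domination: the weight lies in [0, 1] almost everywhere, so the product is bounded by [|p|]. *)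
Lemma integrable_weightM (alpha : R -> R) :
  lambda.-integrable `[0, 1] (EFin \o alpha) ->
  {ae lambda, forall x, x \in `[0, 1] -> 0 <= alpha x <= 1} ->
  lambda.-integrable `[0, 1] (EFin \o (fun x => alpha x * p x)).
Proof.
case: p_density => intp p_ge0 intalpha alpha01.
have mp : measurable_fun (`[0, 1] : set R) p.
  by apply/measurable_EFinP; exact: measurable_int intp.
have malpha : measurable_fun (`[0, 1] : set R) alpha.
  by apply/measurable_EFinP; exact: measurable_int intalpha.
have mM : measurable_fun (`[0, 1] : set R) (EFin \o (fun x => alpha x * p x)).
  by apply/measurable_EFinP; exact: measurable_funM.
apply/integrableP; split => //.
have [_] := integrableP _ _ _ intp; apply: le_lt_trans.
apply: ae_ge0_le_integral => //; do 1?exact: measurableT_comp.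
  by apply/measurable_EFinP; exact: measurableT_comp.
apply: filterS alpha01 => x alpha01 x01.
have /andP[alpha0 alpha1] := alpha01 x01.
by rewrite /= lee_fin normrM ger0_norm// ler_piMl.
Qed.

(* The part of the mass at [x] that the map moves to [x / (1 - a)]; the rest of
   it, [p x - left_mass alpha1 x], is moved to [(x - a) / (1 - a)].  Both maps
   agree on [0, a) and on [1 - a, 1], so there the weights play no role. *)
Definition left_mass (alpha1 : R -> R) (x : R) : R :=
  if x < a then p x else if x < 1 - a then alpha1 x * p x else 0.

(** Mass balance at the target [(x - a) / (1 - a)], written at its right preimage [x]; the left
    preimage is [x - a]. *)
Definition transfer_eq (alpha1 : R -> R) (x : R) : Prop :=
  left_mass alpha1 x =
  left_mass alpha1 (x - a) + p x - 1 / (1 - a) * p ((x - a) / (1 - a)).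

Lemma transfer_densityE (alpha1 alpha2 : R -> R) (y : R) :
  0 <= y < 1 ->
  let x := (1 - a) * y + a in
  alpha1 x + alpha2 x = 1 -> alpha1 (x - a) + alpha2 (x - a) = 1 ->
  two_branch_density a (1 - a) (fun z => alpha1 z * p z) y +
  two_branch_density a a (fun z => alpha2 z * p z) y =
  (1 - a) * (left_mass alpha1 (x - a) + (p x - left_mass alpha1 x)).
Proof.
move=> /andP[y0 y1] x.
rewrite /two_branch_density addr0 -/x.
have -> : (1 - a) * y = x - a by rewrite /x addrK.
have xa : a <= x by rewrite /x lerDr mulr_ge0// subr_ge0 ltW.
have x1 : x < 1.
  by rewrite /x -ltrBrDr -[ltRHS]mulr1 ltr_pM2l// subr_gt0.
move: x xa x1 => x xa x1 wx wxa.
have {}wx : alpha2 x = 1 - alpha1 x by rewrite -wx; ring.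
have {}wxa : alpha2 (x - a) = 1 - alpha1 (x - a) by rewrite -wxa; ring.
rewrite /left_mass !patchE !mem_setE !in_itv/= wx wxa.
have -> : 0 <= x - a by rewrite subr_ge0.
have -> : x - a < 1 - a by rewrite ltrD2r.
have -> : x <= 1 by rewrite ltW.
have -> : (x < a) = false by rewrite ltNge xa.
rewrite xa /= !andbT.
(* Outside its interval a restricted function takes the default value [point]. The cases below
   compare [x] with the break of [S1] and [x - a] with that of [S2]; where both maps use the same
   branch, the two weights add up to 1. *)
have pt0 : point = 0 :> R by [].
by case: (lerP (1 - a) x) => ?; case: (ltP (x - a) a) => ? /=; rewrite ?pt0; ring.
Qed.

(** Both measures have integrable densities, [q] and [p], so they agree on Borel sets exactly when
    the densities agree almost everywhere. The substitution [x = (1 - a) * y + a], which respects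
    null sets both ways, gives the balance equation. *)
Lemma S_invariant_transfer (alpha1 alpha2 : R -> R) :
  weight_functions alpha1 alpha2 ->
  S_invariant a alpha1 alpha2 p <->
  {ae lambda, forall x, x \in `[a, 1[ -> transfer_eq alpha1 x}.
Proof.
case=> -[int1 w1_ge0] [int2 w2_ge0] w_sum.
have w01 : {ae lambda, forall x, x \in `[0, 1] ->
    [/\ 0 <= alpha1 x <= 1, 0 <= alpha2 x <= 1 & alpha1 x + alpha2 x = 1]}.
  apply: filterS3 w1_ge0 w2_ge0 w_sum => x w1 w2 w12 x01.
  have := w1 x01; have := w2 x01; have := w12 x01 => e ? ?.
  by split => //; apply/andP; split; lra.
have intM1 : lambda.-integrable `[0, 1] (EFin \o (fun x => alpha1 x * p x)).
  by apply: integrable_weightM => //; apply: filterS w01 => x w /w[].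
have intM2 : lambda.-integrable `[0, 1] (EFin \o (fun x => alpha2 x * p x)).
  by apply: integrable_weightM => //; apply: filterS w01 => x w /w[].
have intp := density_integrable p_density.
pose q := two_branch_density a (1 - a) (fun z => alpha1 z * p z) \+
          two_branch_density a a (fun z => alpha2 z * p z).
have b0 : 0 <= 1 - a by rewrite subr_ge0 ltW.
have b1 : 1 - a <= 1 by rewrite lerBlDr lerDl ltW.
have intq1 := integrable_two_branch_density a_lt1 b0 b1 intM1.
have intq2 := integrable_two_branch_density a_lt1 (ltW a_gt0) (ltW a_lt1) intM2.
have intq : lambda.-integrable [set: R] (EFin \o q).
  exact: (integrableD measurableT intq1 intq2).
have muSE (B : set R) : measurable B -> B `<=` `[0, 1] ->
    muS_of (S1 a) (S2 a) alpha1 alpha2 p B = (\int[lambda]_(y in B) (q y)%:E)%E.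
  move=> mB B01; rewrite /muS_of.
  have -> : S1 a = two_branch_map a (1 - a) by [].
  have -> : S2 a = two_branch_map a a by [].
  rewrite (integral_two_branch_map a_lt1 b0 b1 intM1)//.
  rewrite (integral_two_branch_map a_lt1 (ltW a_gt0) (ltW a_lt1) intM2)//.
  rewrite -integralD//; last 2 first.
  - by apply: integrableS intq1.
  - by apply: integrableS intq2.
have invE : S_invariant a alpha1 alpha2 p <->
    {ae lambda, forall y, y \in `[0, 1[ -> q y = p y}.
  split=> [inv|qp B mB B01].
    have : {ae lambda, forall y, (`[0, 1]%classic : set R) y ->
        (EFin \o q) y = (EFin \o p) y}.
      apply: integral_ae_eq => //.
      - exact: integrableS intq.
      - exact: measurable_int intp.
      - by move=> B B01 mB; rewrite -[RHS](inv B mB B01) muSE.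
    apply: filterS => y /= qpy; rewrite in_itv/= => /andP[y0 y1].
    by apply: EFin_inj; apply: qpy; rewrite /= in_itv/= y0 ltW.
  rewrite muSE// /mu_of; apply: ae_eq_integral => //.
  - by apply: measurable_funTS; exact: measurable_int intq.
  - by apply: measurable_funS (measurable_int _ intp).
  (* [B] may contain the endpoint 1, which the half-open interval omits; it is a null set. *)
  have ne1 : {ae lambda, forall y : R, y != 1}.
    exists [set 1]; split => //; first exact: lebesgue_measure_set1.
    by move=> y /= /negP; rewrite negbK => /eqP.
  apply: filterS2 qp ne1 => y qpy y1 /B01; rewrite /= in_itv/= => /andP[y0 yle1].
  by rewrite /= qpy// in_itv/= y0 lt_neqAle y1.
rewrite invE {invE}.
have b_gt0 : 0 < 1 - a by rewrite subr_gt0.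
have binv_gt0 : 0 < (1 - a)^-1 by rewrite invr_gt0.
have qE : {ae lambda, forall y, y \in `[0, 1[ ->
    q y = p y <-> transfer_eq alpha1 ((1 - a) * y + a)}.
  have w' := ae_affine 0 b_gt0 w01; have w'' := ae_affine a b_gt0 w01.
  apply: filterS2 w' w'' => y /=; rewrite addr0 => w1 w2.
  rewrite in_itv/= => /andP[y0 y1].
  have by0 : 0 <= (1 - a) * y by rewrite mulr_ge0.
  have by1 : (1 - a) * y <= 1 - a by rewrite ler_piMr// ltW.
  have [|_ _ e1] := w1; first by rewrite in_itv/= by0 (le_trans by1).
  have [|_ _ e2] := w2.
    by rewrite in_itv/= addr_ge0 ?(ltW a_gt0)//= -lerBrDr.
  rewrite /q /= transfer_densityE ?y0//; last by rewrite addrK.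
  rewrite /transfer_eq addrK (_ : (1 - a) * y / (1 - a) = y); last first.
    by rewrite mulrC mulKf// gt_eqF.
  set g0 := left_mass _ _; set g1 := left_mass _ _.
  split => [<-|->]; last by field; rewrite gt_eqF.
  by field; rewrite gt_eqF.
split => [qp|tr].
  have : {ae lambda, forall y, y \in `[0, 1[ -> transfer_eq alpha1 ((1 - a) * y + a)}.
    by apply: filterS2 qE qp => y h1 h2 y01; apply/(h1 y01); exact: h2.
  (* The coefficients are those of the inverse substitution [y = (x - a) / (1 - a)]. *)
  move/(ae_affine (- a / (1 - a)) binv_gt0); apply: filterS => x trx.
  rewrite in_itv/= => /andP[xa x1].
  have e : (1 - a)^-1 * x + - a / (1 - a) = (x - a) / (1 - a) by ring.
  move: trx; rewrite e (mulrC (1 - a)) divfK ?gt_eqF// subrK; apply.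
  rewrite in_itv/= divr_ge0 ?subr_ge0// ?(ltW a_lt1)//= ltr_pdivrMr// mul1r.
  by rewrite ltrD2r.
have := ae_affine a b_gt0 tr; apply: filterS2 qE => y h1 h2 y01; apply/(h1 y01).
apply: h2; move: y01; rewrite !in_itv/= => /andP[y0 y1].
rewrite lerDr mulr_ge0//= -ltrBrDr -[ltRHS]mulr1 ltr_pM2l//.
Qed.

End transfer_equation.

(** * Closed form of the recursion along translates by [a] *)

Lemma sum_from_m1_pred (R : realType) (m : nat) (G : int -> R) :
  sum_from_m1 (m%:Z - 1) G = \sum_(j < m.+1) G (j%:Z - 1).
Proof. by rewrite /sum_from_m1 (_ : m%:Z - 1 + 2 = m.+1%:Z)//; lia. Qed.

Lemma sum_from_m1_nat (R : realType) (m : nat) (G : int -> R) :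
  sum_from_m1 m%:Z G = \sum_(j < m.+2) G (j%:Z - 1).
Proof. by rewrite -sum_from_m1_pred; congr sum_from_m1; lia. Qed.

Section telescoping.
Context (R : realType) (a : R) (p alpha1 : R -> R).

Local Notation lambda := (@lebesgue_measure R).
Local Notation g := (left_mass a p alpha1).

(** The right-hand side of (iii). *)
Definition telescoped (m : nat) (x : R) : R :=
  sum_from_m1 m%:Z (fun k => p (x + k%:~R * a))
  - 1 / (1 - a) *
    sum_from_m1 (m%:Z - 1) (fun k => p ((x + k%:~R * a) / (1 - a))).

Lemma telescoped0 (x : R) :
  telescoped 0 x = p (x - a) + p x - 1 / (1 - a) * p ((x - a) / (1 - a)).
Proof.
rewrite /telescoped sum_from_m1_pred sum_from_m1_nat !big_ord_recl !big_ord0 /=.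
by rewrite !addr0 sub0r subrr mul0r addr0 mulN1r.
Qed.

Lemma telescopedS (m : nat) (x : R) :
  telescoped m.+1 x = telescoped m x + p (x + m.+1%:R * a)
    - 1 / (1 - a) * p ((x + m.+1%:R * a - a) / (1 - a)).
Proof.
rewrite /telescoped !sum_from_m1_pred !sum_from_m1_nat.
rewrite big_ord_recr [in X in _ - _ * X]big_ord_recr /=.
have -> : (m.+2%:Z - 1)%:~R = m.+1%:R :> R by rewrite (_ : m.+2%:Z - 1 = m.+1%:Z)//; lia.
have -> : x + (m.+1%:Z - 1)%:~R * a = x + m.+1%:R * a - a.
  by rewrite intrB /=; ring.
by ring.
Qed.

(** Induction on [m]. The start is [x - a], which lies below [a] because [x < 2 * a], so that
    [left_mass] there is [p]. Conversely, consecutive closed forms differ by exactly one balance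
    equation. *)
Lemma transfer_eq_telescoped (x : R) : x \in `[a, 2 * a[ ->
  (forall m : nat, x + m%:R * a < 1 -> transfer_eq a p alpha1 (x + m%:R * a)) <->
  (forall m : nat, x + m%:R * a < 1 -> g (x + m%:R * a) = telescoped m x).
Proof.
rewrite in_itv/= => /andP[ax x2a].
have a_gt0 : 0 < a by lra.
have g0 : g (x - a) = p (x - a) by rewrite /left_mass ifT//; lra.
have step m : x + m.+1%:R * a - a = x + m%:R * a by rewrite -natr1; ring.
have mono m : x + m.+1%:R * a < 1 -> x + m%:R * a < 1.
  by rewrite -(step m); lra.
split => tr m.
  elim: m => [|m IHm] xm1; have := tr _ xm1; rewrite /transfer_eq.
    by rewrite telescoped0 mul0r addr0 g0.
  by rewrite telescopedS step -IHm//; exact: mono.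
case: m => [|m] xm1; have := tr _ xm1; rewrite /transfer_eq => ->.
  by rewrite telescoped0 mul0r addr0 g0.
by rewrite telescopedS step -tr//; exact: mono.
Qed.

(** The translates of [[a, 2a[] by multiples of [a] cover [[a, 1[], and countably many null sets
    have a null union. *)
Lemma ae_transfer_eq_telescoped : 0 < a ->
  {ae lambda, forall x, x \in `[a, 1[ -> transfer_eq a p alpha1 x} <->
  {ae lambda, forall x, x \in `[a, 2 * a[ ->
    forall m : nat, x + m%:R * a < 1 -> g (x + m%:R * a) = telescoped m x}.
Proof.
move=> a_gt0; split => tr.
  have {}tr : {ae lambda, forall x, forall m : nat,
      x + m%:R * a \in `[a, 1[ -> transfer_eq a p alpha1 (x + m%:R * a)}.
    apply: ae_foralln => m; have := ae_affine (m%:R * a) ltr01 tr.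
    by apply: filterS => x; rewrite mul1r.
  apply: filterS tr => x tr x2a; apply/(transfer_eq_telescoped x2a) => m xm1.
  move: x2a; rewrite in_itv/= => /andP[ax _].
  by apply: tr; rewrite in_itv/= xm1 (le_trans ax)// lerDl mulr_ge0 // ltW.
have {}tr : {ae lambda, forall x, forall m : nat, x - m%:R * a \in `[a, 2 * a[ ->
    x < 1 -> transfer_eq a p alpha1 x}.
  apply: ae_foralln => m; have := ae_affine (- (m%:R * a)) ltr01 tr.
  apply: filterS => x; rewrite mul1r => trx x2a x1.
  have /(transfer_eq_telescoped x2a)/(_ m) := trx x2a.
  by rewrite subrK; exact.
apply: filterS tr => x trx; rewrite in_itv/= => /andP[ax x1].
(* The number of steps back from [x] into [[a, 2a[] is the integer part of [(x - a) / a]. *)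
have xa_ge0 : 0 <= (x - a) / a by rewrite divr_ge0 ?subr_ge0// ltW.
have /andP[] := truncn_itv xa_ge0.
rewrite ler_pdivlMr// ltr_pdivrMr// -natr1 => lo hi.
apply: (trx (Num.truncn ((x - a) / a))) => //.
by rewrite in_itv/=; move: (Num.truncn _)%:R lo hi => t lo hi; apply/andP; split; lra.
Qed.

End telescoping.

(** * Matching the closed form with (i), (ii) and (iii) *)

Section conditions.
Context (R : realType) (a : R) (p alpha1 : R -> R) (n : nat).
Context (hn : (2 <= n)%N) (ha : 1 / n.+1%:R < a <= 1 / n%:R).

Local Notation lambda := (@lebesgue_measure R).
Local Notation g := (left_mass a p alpha1).

(** For [m <= n - 3] the point [x + m a] lies in [[a, 1 - a[], which gives the first part of (iii).
    For [m = n - 2] it lies there exactly when [x < 1 - (n - 1) a], the last part of (iii);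
    otherwise [g] vanishes, which is (ii). For [m = n - 1] it lies beyond [1 - a], which gives
    (i). *)
Lemma conditions_telescoped :
  {ae lambda, forall x, x \in `[a, 2 * a[ ->
    forall m : nat, x + m%:R * a < 1 -> g (x + m%:R * a) = telescoped a p m x} <->
  [/\ cond_i n a p, cond_ii n a p & cond_iii n a alpha1 p].
Proof.
have n_gt0 : 0 < n%:R :> R by rewrite ltr0n; lia.
have [na1 Sna1] : n%:R * a <= 1 /\ 1 < (n%:R + 1) * a.
  move: ha => /andP[]; rewrite ltr_pdivrMr ?ltr0n// ler_pdivlMr// natr1.
  by rewrite (mulrC a) (mulrC a).
have a_gt0 : 0 < a.
  by move: ha => /andP[+ _]; apply: lt_trans; rewrite divr_gt0 ?ltr0n.
(* The natural subtraction [n - 2] is not truncated, as [n >= 2]. *)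
have nE : n%:R = (n - 2)%:R + 2 :> R by rewrite -natrD; congr _%:R; lia.
have g_mid z : a <= z < 1 - a -> g z = alpha1 z * p z.
  by move=> /andP[az z1]; rewrite /left_mass ltNge az /= z1.
have g_end z : a <= z -> 1 - a <= z -> g z = 0.
  by move=> az z1; rewrite /left_mass !ltNge az z1.
have tel_i x : telescoped a p n.-1 x = 0 <->
    sum_from_m1 (n%:Z - 1) (fun k => p (x + k%:~R * a)) =
    1 / (1 - a) *
      sum_from_m1 (n%:Z - 2) (fun k => p ((x + k%:~R * a) / (1 - a))).
  rewrite /telescoped (_ : n.-1%:Z = n%:Z - 1); last by lia.
  rewrite (_ : n%:Z - 1 - 1 = n%:Z - 2); last by lia.
  by split => [/eqP|->]; rewrite ?subrr// subr_eq0 => /eqP.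
have tel_ii x : telescoped a p (n - 2) x = 0 <->
    sum_from_m1 (n%:Z - 2) (fun k => p (x + k%:~R * a)) =
    1 / (1 - a) *
      sum_from_m1 (n%:Z - 3) (fun k => p ((x + k%:~R * a) / (1 - a))).
  rewrite /telescoped (_ : (n - 2)%:Z = n%:Z - 2); last by lia.
  rewrite (_ : n%:Z - 2 - 1 = n%:Z - 3); last by lia.
  by split => [/eqP|->]; rewrite ?subrr// subr_eq0 => /eqP.
have predE : n.-1%:R = n%:R - 1 :> R by rewrite -subn1 natrB//; lia.
have ma_le m : (m + 3 <= n)%N -> m%:R * a <= n%:R * a - 3 * a.
  move=> mn; rewrite -mulrBl ler_pM2r// lerBrDr -natrD ler_nat//.
have ma_ge0 (m : nat) : 0 <= m%:R * a by rewrite mulr_ge0// ltW.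
have n2a : 2 * a <= n%:R * a by rewrite ler_pM2r// ler_nat.
split=> [tel|[ci cii [ciii1 ciii2]]].
  split; [| |split].
  - apply: filterS tel => x tel; rewrite in_itv/= => /andP[ax x1].
    apply/tel_i; rewrite -tel.
    + by rewrite predE; apply: g_end; lra.
    + by rewrite in_itv/= ax/=; lra.
    + by rewrite predE; lra.
  - apply: filterS tel => x tel; rewrite in_itv/= => /andP[ax x1].
    apply/tel_ii; rewrite -tel.
    + by apply: g_end; move: na1 Sna1 ax; rewrite nE; have := ma_ge0 (n - 2)%N; lra.
    + by rewrite in_itv/= x1 andbT; lra.
    + by move: na1 x1; rewrite nE; lra.
  - move=> m mn; apply: filterS tel => x tel.
    rewrite in_itv/= => /andP[ax x1]; have := ma_le m mn.
    move=> mle; rewrite /weight_eq -g_mid.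
      by apply: tel; rewrite ?in_itv/=; lra.
    by have := ma_ge0 m; lra.
  - apply: filterS tel => x tel.
    rewrite in_itv/= => /andP[ax x1].
    rewrite /weight_eq -g_mid.
      by apply: tel; move: na1 Sna1 ax x1; rewrite ?in_itv/= nE; lra.
    by move: na1 Sna1 ax x1; rewrite nE; have := ma_ge0 (n - 2)%N; lra.
(* Larger [m] are covered vacuously, so a countable intersection yields one exceptional null set for
   all [m]. *)
have {}ciii1 : {ae lambda, forall x, forall m : nat, (m + 3 <= n)%N ->
    x + m%:R * a \in `[(m%:R + 1) * a, (m%:R + 2) * a[ ->
    weight_eq a alpha1 p m x}.
  apply: ae_foralln => m; have [mn|mn] := leqP (m + 3) n.
    by apply: filterS (ciii1 m mn) => x.
  exact: aeW.
have {ciii1 ciii2}ciii : {ae lambda, forall x, (forall m : nat, (m + 3 <= n)%N ->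
    x + m%:R * a \in `[(m%:R + 1) * a, (m%:R + 2) * a[ ->
    weight_eq a alpha1 p m x) /\
    (x + (n - 2)%N%:R * a \in `[(n%:R - 1) * a, 1 - a[ ->
    weight_eq a alpha1 p (n - 2)%N x)}.
  by apply: filterS2 ciii1 ciii2.
apply: filterS3 ci cii ciii => x ci cii [ciii1 ciii2].
rewrite in_itv/= => /andP[ax x2a] m xm1.
(* If [m >= n], then [x + m a >= (n + 1) a > 1]. *)
have mn : (m < n)%N.
  rewrite ltnNge; apply/negP; rewrite -(ler_nat R) => nm.
  by have : n%:R * a <= m%:R * a by [rewrite ler_pM2r]; lra.
have [mn3|mn3] := leqP (m + 3) n.
  rewrite g_mid; first by apply: ciii1; rewrite ?in_itv//=; lra.
  by have := ma_le m mn3; have := ma_ge0 m; lra.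
have [mE|mE] : m = n.-1 \/ m = (n - 2)%N by clear -mn mn3; lia.
  rewrite mE in xm1 *; rewrite (tel_i x).2.
    by rewrite predE in xm1 *; apply: g_end; lra.
  by apply: ci; rewrite in_itv/= ax -predE; lra.
rewrite mE {mE mn3 mn xm1}.
have [x_lt|x_ge] := ltP x (1 - (n%:R - 1) * a).
  rewrite g_mid; first by apply: ciii2; move: x_lt; rewrite in_itv/= nE; lra.
  by move: x_lt; have := ma_ge0 (n - 2)%N; rewrite nE; lra.
rewrite (tel_ii x).2; last by apply: cii; rewrite in_itv/= x_ge.
by apply: g_end; move: x_ge; have := ma_ge0 (n - 2)%N; rewrite nE; lra.
Qed.

End conditions.

(** * Dependence on the weights, and the conclusion *)

(** [left_mass] reads its weight only on [[a, 1 - a[]; a translation by [-a] handles its value at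
    [x - a]. *)
Lemma eq_ae_transfer_eq (R : realType) (a : R) (p alpha1 beta1 : R -> R) :
  {ae @lebesgue_measure R, forall x, x \in `[a, 1 - a[ -> beta1 x = alpha1 x} ->
  {ae @lebesgue_measure R, forall x, x \in `[a, 1[ -> transfer_eq a p alpha1 x} ->
  {ae @lebesgue_measure R, forall x, x \in `[a, 1[ -> transfer_eq a p beta1 x}.
Proof.
move=> e; have e' : {ae @lebesgue_measure R, forall x,
    left_mass a p beta1 x = left_mass a p alpha1 x}.
  apply: filterS e => x e; rewrite /left_mass.
  case: ltP => // ax; case: ltP => // xa.
  by rewrite e// in_itv/= ax.
have := ae_affine (- a) ltr01 e'; apply: filterS3 e' => x e0 e1 tr x01.
by rewrite mul1r in e1; rewrite /transfer_eq e0 e1; exact: tr.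
Qed.

Theorem theorem1 (R : realType) (n : nat) (a : R) (p alpha1 alpha2 : R -> R)
    (hn : (2 <= n)%N) (ha : 1 / n.+1%:R < a <= 1 / n%:R)
    (hp : density p) (halpha : weight_functions alpha1 alpha2) :
  (S_invariant a alpha1 alpha2 p <->
     [/\ cond_i n a p, cond_ii n a p & cond_iii n a alpha1 p])
  /\
  (forall beta1 beta2 : R -> R, weight_functions beta1 beta2 ->
     {ae @lebesgue_measure R, forall x, x \in `[a, 1 - a[ -> beta1 x = alpha1 x} ->
     (S_invariant a alpha1 alpha2 p <-> S_invariant a beta1 beta2 p)).
Proof.
have a_gt0 : 0 < a.
  by case/andP: ha => + _; apply: lt_trans; rewrite divr_gt0 ?ltr0n.
have a_le2 : a <= 1 / 2.
  case/andP: ha => _ /le_trans; apply.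
  by rewrite !div1r lef_pV2 ?posrE ?ler_nat ?ltr0n// (leq_trans _ hn).
split=> [|beta1 beta2 hbeta beta_eq].
  apply: iff_trans (S_invariant_transfer a_gt0 a_le2 hp halpha) _.
  apply: iff_trans (ae_transfer_eq_telescoped p alpha1 a_gt0) _.
  exact: conditions_telescoped.
apply: iff_trans (S_invariant_transfer a_gt0 a_le2 hp halpha) _.
apply: iff_trans _ (iff_sym (S_invariant_transfer a_gt0 a_le2 hp hbeta)).
split; apply: eq_ae_transfer_eq => //.
by apply: filterS beta_eq => x e x01; rewrite e.
Qed.
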